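(* Consider the discrete-time partially observable Markov decision model with cost $\tilde J$ and the filtered Markov decision model on $\mathcal P(E^0)$ with cost $V(\rho,\pi)$ built with the (unregularized) filter $\Psi$, as defined in the context. Assume that $E^0\subset\mathbb R^d$ is finite with $Q^A(E^0|y,a)=1$ for all $(y,a)\in\mathbb R^d\times A$ and $Q_0(E^0|x)=1$ for all $x$, and that $Q_\epsilon$ has a bounded density $f_\epsilon$ with respect to a $\sigma$-finite measure $\nu$, with $Q_\epsilon(D-y')=\int_Df_\epsilon(x-y')\nu(dx)$ for all Borel $D$ and $y'\in E^0$. Let $x\in\mathbb R^d$ be an initial observation, $\pi=(f_0,f_1,\dots)\in\Pi^\infty$ and let $\pi^D\in\Pi^D$ be given by $\pi^D_n(h_n)=f_n(\mu_n(\cdot|h_n))$. Then $$V(Q_0(\cdot|x),\pi)=\tilde J(x,\pi^D).$$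
   Context: Standing assumptions: $A$ is a compact metric space; $\lambda^A:\mathbb R^d\times A\to(0,\infty)$ is continuous with $\underline\lambda\le\lambda^A\le\bar\lambda$ for constants $0<\underline\lambda\le\bar\lambda<\infty$; $Q^A$ is a transition kernel from $\mathbb R^d\times A$ to $\mathbb R^d$ such that $(y,a)\mapsto\int v(z)Q^A(dz|y,a)$ is continuous and bounded for every continuous bounded $v$. $\mathcal P(A)$ is the set of Borel probability measures on $A$ with the weak topology. $\mathcal R$ is the set of measurable maps $r=(r_t)_{t\ge0}:[0,\infty)\to\mathcal P(A)$ (a.e. equal maps identified) with the Young topology ($r^n\to r$ iff $\int_0^\infty\int_A\psi(t,a)r^n_t(da)dt\to\int_0^\infty\int_A\psi(t,a)r_t(da)dt$ for all $\psi:[0,\infty)\times A\to\mathbb R$ measurable in $t$, continuous and bounded in $a$, with $\int_0^\infty\sup_a|\psi(t,a)|dt<\infty$) and its Borel $\sigma$-algebra. For each $r\in\mathcal R$, $\Phi^r:\mathbb R^d\times[0,\infty)\to\mathbb R^d$ is continuous with $\Phi^r(y,t+s)=\Phi^r(\Phi^r(y,s),t)$. $Q_\epsilon$ is a probability distribution on $\mathbb R^d$; $Q_0(\cdot|x)$ a transition kernel from $\mathbb R^d$ to $\mathbb R^d$; $\beta\ge0$; $c:\mathbb R^d\times A\to[0,\infty)$ is measurable. All maps are jointly measurable as needed for the integrals below. $\Gamma^r(y,t)=\beta t+\int_0^t\int_A\lambda^A(\Phi^r(y,u),a)r_u(da)du$. Histories: $\mathcal H_0=\mathbb R^d$, $\mathcal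 H_n=\mathcal H_{n-1}\times\mathcal R\times[0,\infty)\times\mathbb R^d$, elements $h_n=(x_0,r_0,s_1,x_1,\dots,r_{n-1},s_n,x_n)$. $\Pi^D$: sequences of measurable maps $\pi_n:\mathcal H_n\to\mathcal R$. Partially observable model: let $$\tilde q(s,y',x|y,r)=e^{-\Gamma^r(y,s)}f_\epsilon(x-y')\int_A\lambda^A(\Phi^r(y,s),a)Q^A(\{y'\}|\Phi^r(y,s),a)r_s(da),\quad s\ge0,\ y,y'\in E^0,\ x\in\mathbb R^d,$$ and $\tilde q^{SX}(s,x|y,r)=\sum_{y'\in E^0}\tilde q(s,y',x|y,r)$. For $\pi\in\Pi^D$, $\tilde{\mathbb P}^\pi_x$ is the (substochastic) law of $(S_n,\hat Y_n,X_n)_n$ with $X_0=x$, $\hat Y_0\sim Q_0(\cdot|x)$ and, given the past, $(S_n,\hat Y_n,X_n)$ has density $\tilde q(s,y',x'|\hat Y_{n-1},\pi_{n-1}(H_{n-1}))$ with respect to Lebesgue measure $ds$ times counting measure on $E^0$ times $\nu(dx')$; $H_n=(X_0,\pi_0(H_0),S_1,X_1,\dots,\pi_{n-1}(H_{n-1}),S_n,X_n)$. With $g(y,r)=\int_0^\infty e^{-\Gamma^r(y,t)}\int_Ac(\Phi^r(y,t),a)r_t(da)dt$ the cost is $\tilde J(x,\pi)=\tilde{\mathbb E}^\pi_x\big[\sum_{k=0}^\infty g(\hat Y_k,\pi_k(H_k))\big]$ (sum over $k$ of the integrals with respect to the substochastic law of the first $k$ transitions). Filter: $$\Psi(\rho,r,s,x)(y')=\frac{\sum_{y\in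 E^0}\tilde q(s,y',x|y,r)\rho(y)}{\sum_{\hat y\in E^0}\sum_{y\in E^0}\tilde q(s,\hat y,x|y,r)\rho(y)}$$ (a fixed arbitrary element of $\mathcal P(E^0)$ where the denominator vanishes); $\mu_0(\cdot|x_0)=Q_0(\cdot|x_0)$, $\mu_n(\cdot|h_n)=\Psi(\mu_{n-1}(\cdot|h_{n-1}),r_{n-1},s_n,x_n)$. Filtered model: state space $\mathcal P(E^0)$, action space $\mathcal R$, (substochastic) transition kernel $\hat Q(B|\rho,r)=\int_0^\infty\int_{\mathbb R^d}\sum_{y\in E^0}1_B(\Psi(\rho,r,s,x))\tilde q^{SX}(s,x|y,r)\rho(y)\,\nu(dx)ds$, one-stage cost $\hat g(\rho,r)=\sum_{y\in E^0}g(y,r)\rho(y)$. $\Pi$ is the set of measurable $f:\mathcal P(E^0)\to\mathcal R$. For $\pi=(f_0,f_1,\dots)\in\Pi^\infty$ and $\rho\in\mathcal P(E^0)$, $V(\rho,\pi)=\hat{\mathbb E}^\pi_\rho\big[\sum_{n=0}^\infty\hat g(\mu_n,f_n(\mu_n))\big]$, where under $\hat{\mathbb P}^\pi_\rho$ the state process starts in $\mu_0=\rho$ and moves from $\mu_n$ to $\mu_{n+1}$ according to $\hat Q(\cdot|\mu_n,f_n(\mu_n))$ (again summed with respect to substochastic laws). *)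

(* Defs.v *)
From HB Require Import structures.
From mathcomp Require Import all_boot all_order all_algebra finmap.
From mathcomp Require Import all_classical all_reals all_analysis.

Set Implicit Arguments.
Unset Strict Implicit.
Unset Printing Implicit Defensive.

Import Order.TTheory GRing.Theory Num.Theory.
Import numFieldNormedType.Exports.

Local Open Scope classical_set_scope.
Local Open Scope ring_scope.

Notation borel T := (g_sigma_algebraType (open : set (set T))).

(* Measurable types of the library are pointed, hence the distinguished point;
   it only says that the space is nonempty. *)
#[short(type="pmetricType")]
HB.structure Definition PointedMetric (K : numDomainType) :=
  { M of Metric K M & Pointed M }.

Section time.
Variable R : realType.

Definition time : Type := {nonneg R}.
Definition time_val (t : time) : R := t%:num.

HB.instance Definition _ := Choice.on time.
HB.instance Definition _ := isPointed.Build time (0%:nng : {nonneg R}).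
HB.instance Definition _ := Topological.copy time (initial_topology time_val).

Definition time_add (t s : time) : time := (t%:num + s%:num)%:nng.

(* The trace on [0, oo) of the Lebesgue measure of R. *)
Definition time_leb (B : set (borel time)) : \bar R :=
  lebesgue_measure (time_val @` B).

End time.

Section time_measure.
Variable R : realType.

Lemma time_val_inj : injective (@time_val R).
Proof. by move=> s t; exact: val_inj. Qed.

Lemma range_time_val : range (@time_val R) = `[0, +oo[%classic.
Proof.
apply/seteqP; split => [_ [t _ <-]|s] /=; rewrite in_itv/= andbT.
  exact: (ge0 (t : {nonneg R})).
by move=> s0; exists (NngNum s0).
Qed.

Lemma measurable_image_time_val (B : set (borel (time R))) :
  measurable B -> measurable (@time_val R @` B : set (measurableTypeR R)).
Proof.
have m0 : measurable (`[0, +oo[%classic : set (measurableTypeR R)) by [].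
pose G := [set B : set (time R) |
  measurable (@time_val R @` B : set (measurableTypeR R))].
apply: (@smallest_sub _ (sigma_algebra setT) open G); last first.
  move=> _ [U oU <-]; rewrite /G/=.
  rewrite (_ : _ @` _ = U `&` `[0, +oo[%classic); last first.
    rewrite -range_time_val; apply/seteqP; split => [_ [t Ut <-]|s].
      by split=> //; exists t.
    by move=> [Us [t _ ts]]; exists t => //; rewrite /preimage/= ts.
  by apply: measurableI => //; exact: measurable_realfun.open_measurable.
split=> [|C GC|F GF]; rewrite /G/=.
- by rewrite image_set0.
- rewrite (_ : _ @` _ = `[0, +oo[%classic `\` (@time_val R @` C)).
    exact: measurableD.
  rewrite -range_time_val; apply/seteqP; split => [_ [t [_ Ct] <-]|].
    by split; [exists t | move=> [u Cu /time_val_inj ut]; apply: Ct; rewrite -ut].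
  by move=> _ [[t _ <-] Ct]; exists t => //; split=> // tC; apply: Ct; exists t.
- by rewrite image_bigcup; apply: bigcup_measurable => k _; exact: GF.
Qed.

Let time_leb0 : time_leb set0 = 0%E :> \bar R.
Proof. by rewrite /time_leb image_set0 measure0. Qed.

Let time_leb_ge0 (B : set (borel (time R))) : (0 <= time_leb B)%E.
Proof. exact: measure_ge0. Qed.

Let time_leb_sigma_additive : semi_sigma_additive (@time_leb R).
Proof.
move=> F mF tF mUF; rewrite /time_leb image_bigcup.
apply: measure_semi_sigma_additive.
- by move=> n; exact: measurable_image_time_val.
- move=> i j _ _ [_ [[t Ft <-] [u Fu /time_val_inj ut]]].
  by apply: (tF i j) => //; exists t; split=> //; rewrite -ut.
- by rewrite -image_bigcup; exact: measurable_image_time_val.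
Qed.

HB.instance Definition _ := isMeasure.Build _ _ _ (@time_leb R)
  time_leb0 time_leb_ge0 time_leb_sigma_additive.

End time_measure.

Section controls.
Variables (R : realType) (A : pmetricType R).

(* Elements of [probability _ R] also carry values on nonmeasurable sets, so
   Borel probability measures are obtained by identifying those that agree on
   the Borel sets. *)
Definition same_measure (m1 m2 : probability (borel A) R) : bool :=
  `[< forall B, measurable B -> m1 B = m2 B >].

Let same_measure_refl : reflexive same_measure.
Proof. by move=> m; apply/asboolP. Qed.

Let same_measure_sym : symmetric same_measure.
Proof.
by move=> m1 m2; apply/asboolP/asboolP => m12 B mB; rewrite m12.
Qed.

Let same_measure_trans : transitive same_measure.
Proof.
move=> m2 m1 m3 /asboolP m12 /asboolP m23; apply/asboolP => B mB.
by rewrite m12// m23.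
Qed.

Canonical same_measure_canonical :=
  EquivRel same_measure same_measure_refl same_measure_sym same_measure_trans.

Local Open Scope quotient_scope.

Definition prob : Type := {eq_quot same_measure}.

HB.instance Definition _ := Choice.on prob.
HB.instance Definition _ := EqQuotient.on prob.
HB.instance Definition _ := isPointed.Build prob (\pi point).

Definition prob_measure (m : prob) : probability (borel A) R := repr m.

Definition bcont := {v : A -> R | continuous v /\ bounded_fun v}.

Definition prob_int (m : prob) : {ptws bcont -> R} :=
  fun v => \int[prob_measure m]_a (sval v a).

(* The weak topology. *)
HB.instance Definition _ := Topological.copy prob (initial_topology prob_int).

(* Measurable maps [0, oo) -> P(A) up to a.e. equality. *)
Definition relaxed : Type :=
  {mfun_ (@time_leb R), borel (time R) >-> borel prob}.

HB.instance Definition _ := Choice.on relaxed.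
HB.instance Definition _ := EqQuotient.on relaxed.
HB.instance Definition _ := isPointed.Build relaxed
  (\pi_relaxed (cst point : {mfun borel (time R) >-> borel prob})).

Record young_fun := YoungFun {
  young_val :> time R -> A -> R ;
  young_measurable : forall a,
    measurable_fun [set: borel (time R)] (young_val ^~ a) ;
  young_continuous : forall t, continuous (young_val t) ;
  young_bounded : forall t, bounded_fun (young_val t) ;
  young_integrable :
    (\int[@time_leb R]_t ereal_sup [set `|young_val t a|%:E | a in [set: A]]
     < +oo)%E }.

Definition relaxed_int (r : relaxed) : {ptws young_fun -> R} :=
  fun psi => \int[@time_leb R]_t
    \int[prob_measure (aqEqMfun_to_fun r t)]_a psi t a.

(* The Young topology. *)
HB.instance Definition _ :=
  Topological.copy relaxed (initial_topology relaxed_int).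

End controls.

Section massfun.
Variables (R : realType) (E : finType).

Definition massfun : Type :=
  {rho : {ffun E -> R} | [forall y, 0 <= rho y] && (\sum_y rho y == 1)}.

HB.instance Definition _ := Choice.on massfun.

Definition massfun_val (rho : massfun) : {ptws E -> R} := fun y => sval rho y.

(* The weak topology on P(E) for a finite discrete space E. *)
HB.instance Definition _ := Topological.copy massfun (initial_topology massfun_val).

End massfun.

Notation space R d := (borel 'rV[R]_d).

Record model (R : realType) (d : nat) (A : pmetricType R) := Model {
  act_compact : compact [set: A] ;
  lambda : 'rV[R]_d * A -> R ;
  lambda_continuous : continuous lambda ;
  lambda_bounds : exists lo hi : R, [/\ 0 < lo, lo <= hi &
    forall p, lo <= lambda p <= hi] ;
  lambda_measurable :
    measurable_fun [set: space R d * borel A]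
      (lambda : space R d * borel A -> R) ;
  QA : R.-pker (space R d * borel A) ~> (space R d) ;
  QA_continuous : forall v : 'rV[R]_d -> R, continuous v -> bounded_fun v ->
    continuous (fun p : 'rV[R]_d * A => \int[QA p]_z v z) /\
    bounded_fun (fun p : 'rV[R]_d * A => \int[QA p]_z v z) ;
  flow : relaxed A -> 'rV[R]_d -> time R -> 'rV[R]_d ;
  flow_continuous : forall r,
    continuous (fun p : 'rV[R]_d * time R => flow r p.1 p.2) ;
  flow_semigroup : forall r y t s,
    flow r y (time_add t s) = flow r (flow r y s) t ;
  flow_measurable :
    measurable_fun [set: borel (relaxed A) * space R d * borel (time R)]
      ((fun p => flow p.1.1 p.1.2 p.2) :
         borel (relaxed A) * space R d * borel (time R) -> space R d) ;
  (* [ctrl r t] is the measure r_t. As r is an a.e. class, evaluating it at t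
     takes a choice of representatives; one that is jointly measurable in (r, t)
     is needed to integrate r_t-averages against laws of r and t. *)
  ctrl : relaxed A -> time R -> prob A ;
  ctrl_version : forall r : relaxed A,
    {ae @time_leb R, forall t, ctrl r t = aqEqMfun_to_fun r t} ;
  ctrl_measurable :
    measurable_fun [set: borel (relaxed A) * borel (time R)]
      ((fun p => ctrl p.1 p.2) :
         borel (relaxed A) * borel (time R) -> borel (prob A)) ;
  beta : R ;
  beta_ge0 : 0 <= beta ;
  cost : 'rV[R]_d * A -> R ;
  cost_ge0 : forall p, 0 <= cost p ;
  cost_measurable :
    measurable_fun [set: space R d * borel A] (cost : space R d * borel A -> R) ;
  Q0 : R.-pker (space R d) ~> (space R d) ;
  E0 : {fset 'rV[R]_d} ;
  QA_E0 : forall p, QA p [set` E0] = 1%E ;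
  Q0_E0 : forall x, Q0 x [set` E0] = 1%E ;
  Qeps : probability (space R d) R ;
  nu : {sigma_finite_measure set (space R d) -> \bar R} ;
  feps : 'rV[R]_d -> R ;
  feps_measurable : measurable_fun [set: space R d] (feps : space R d -> R) ;
  feps_ge0 : forall z, 0 <= feps z ;
  feps_bounded : bounded_fun feps ;
  feps_density : forall D : set (space R d), measurable D ->
    Qeps D = (\int[nu]_(z in D) (feps z)%:E)%E ;
  feps_shift : forall (D : set (space R d)) (y : 'rV[R]_d), measurable D ->
    y \in E0 ->
    Qeps [set x - y | x in D] = (\int[nu]_(x in D) (feps (x - y))%:E)%E ;
  (* value of the filter where its denominator vanishes *)
  rho_bar : massfun R E0 }.

(* Packs the display, which depends on n in the families hist and traj below. *)
Record mtype := MType {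
  mdisp : measure_display ;
  mcarrier :> measurableType mdisp }.
Arguments MType {mdisp} mcarrier.

Section model_theory.
Variables (R : realType) (d : nat) (A : pmetricType R) (M : model d A).

Local Notation X := (space R d).
Local Notation T := (time R).
Local Notation leb := (@time_leb R).
Local Notation ctr := (relaxed A).

Definition ctrl_measure (r : ctr) (t : T) := prob_measure (ctrl M r t).

Definition Gamma (y : X) (r : ctr) (t : T) : R :=
  beta M * t%:num +
  \int[leb]_(u in [set u : T | u%:num <= t%:num])
    \int[ctrl_measure r u]_a lambda M (flow M r y u, a).

Definition qtilde (s : T) (y' x y : X) (r : ctr) : R :=
  expR (- Gamma y r s) * feps M (x - y') *
  \int[ctrl_measure r s]_a
    (lambda M (flow M r y s, a) * fine (QA M (flow M r y s, a) [set y'])).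

Definition qtildeSX (s : T) (x y : X) (r : ctr) : R :=
  \sum_(y' : E0 M) qtilde s (val y') x y r.

Definition gcost (y : X) (r : ctr) : \bar R :=
  (\int[leb]_t ((expR (- Gamma y r t))%:E *
     \int[ctrl_measure r t]_a (cost M (flow M r y t, a))%:E))%E.

(* P(E0), pointed by rho_bar. *)
Definition belief : Type := massfun R (E0 M).
HB.instance Definition _ := Choice.on belief.
HB.instance Definition _ := Topological.on belief.
HB.instance Definition _ := isPointed.Build belief (rho_bar M).

Implicit Types (rho : belief) (r : ctr).

Definition filter_num rho r s x (y' : E0 M) : R :=
  \sum_(y : E0 M) qtilde s (val y') x (val y) r * massfun_val rho y.

Definition filter_den rho r s x : R := \sum_(y' : E0 M) filter_num rho r s x y'.

Lemma qtilde_ge0 s y' x y r : 0 <= qtilde s y' x y r.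
Proof.
apply: mulr_ge0; first by rewrite mulr_ge0 ?expR_ge0 ?feps_ge0.
apply: Rintegral_ge0 => a _; apply: mulr_ge0; last exact: fine_ge0.
have [lo [hi [lo0 _ lohi]]] := lambda_bounds M.
by have /andP[+ _] := lohi (flow M r y s, a); apply: le_trans; exact: ltW.
Qed.

Lemma massfun_ge0 rho y : 0 <= massfun_val rho y.
Proof. by have /andP[/forallP/(_ y)] := svalP rho. Qed.

Lemma filter_num_ge0 rho r s x y' : 0 <= filter_num rho r s x y'.
Proof. by apply: sumr_ge0 => y _; rewrite mulr_ge0 ?qtilde_ge0 ?massfun_ge0. Qed.

Definition filter_fun rho r s x : {ffun E0 M -> R} :=
  if filter_den rho r s x == 0 then sval (rho_bar M)
  else [ffun y' => filter_num rho r s x y' / filter_den rho r s x].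

Lemma filter_fun_massfun rho r s x :
  [forall y', 0 <= filter_fun rho r s x y'] &&
  (\sum_y' filter_fun rho r s x y' == 1).
Proof.
rewrite /filter_fun; case: ifPn => [_|den0].
  exact: (svalP (rho_bar M)).
apply/andP; split.
  apply/forallP => y'; rewrite ffunE divr_ge0 ?filter_num_ge0//.
  by apply: sumr_ge0 => ? _; exact: filter_num_ge0.
by under eq_bigr do rewrite ffunE; rewrite -mulr_suml divff.
Qed.

Definition Psi rho r s x : belief :=
  exist (fun p : {ffun E0 M -> R} => [forall y, 0 <= p y] && (\sum_y p y == 1))
    (filter_fun rho r s x) (filter_fun_massfun rho r s x).

Definition prior_fun (x : X) : {ffun E0 M -> R} :=
  [ffun y => fine (Q0 M x [set val y])].

Lemma measurable_set1_space (y : X) : measurable [set y].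
Proof.
have cy : closed [set (y : 'rV[R]_d)].
  by apply: accessible_closed_set1; exact/hausdorff_accessible/norm_hausdorff.
rewrite -(setCK [set y]); apply: measurableC.
by apply: sub_sigma_algebra; exact: closed_openC.
Qed.

Lemma prior_fun_massfun x :
  [forall y, 0 <= prior_fun x y] && (\sum_y prior_fun x y == 1).
Proof.
apply/andP; split; first by apply/forallP => y; rewrite ffunE fine_ge0.
under eq_bigr do rewrite ffunE.
apply/eqP; apply: EFin_inj; rewrite -sumEFin.
have finQ y : Q0 M x [set y] \is a fin_num.
  apply: (@kernel_finite_transition _ _ _ _ _ (Q0 M) x [set y]).
  exact: measurable_set1_space.
under eq_bigr do rewrite fineK//.
rewrite -(Q0_E0 M x) -[in RHS](image_id [set` E0 M]) -bigcup_imset1.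
rewrite measure_fin_bigcup//; first last.
- by move=> y _; exact: measurable_set1_space.
- by move=> y z _ _ [w [/= -> ->]].
by rewrite -fsbig_seq// big_seq_fsetE.
Qed.

(* Q_0( . |x) as an element of P(E0). *)
Definition prior (x : X) : belief :=
  exist (fun p : {ffun E0 M -> R} => [forall y, 0 <= p y] && (\sum_y p y == 1))
    (prior_fun x) (prior_fun_massfun x).

(* Histories h_n are nested tuples (h_(n-1), r_(n-1), s_n, x_n). *)
Fixpoint hist (n : nat) : mtype :=
  if n is m.+1 then MType (hist m * borel ctr * borel T * X)%type else MType X.

Definition policy := forall n, hist n -> ctr.

Definition PiD (pi : policy) : Prop :=
  forall n, measurable_fun [set: hist n] (pi n : hist n -> borel ctr).

Fixpoint mu (n : nat) : hist n -> belief :=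
  match n return hist n -> belief with
  | 0 => fun x => prior x
  | m.+1 => fun h => Psi (mu h.1.1.1) h.1.1.2 h.1.2 h.2
  end.

(* Trajectories (X_0, Y_0, (S_1, Y_1, X_1), ..., (S_n, Y_n, X_n)), nested to
   the left; the Y_k range over R^d, their law being carried by E0. *)
Fixpoint traj (n : nat) : mtype :=
  if n is m.+1 then MType (traj m * (borel T * X * X))%type
  else MType (X * X)%type.

Definition traj_Y (n : nat) : traj n -> X :=
  match n return traj n -> X with
  | 0 => fun w => w.2
  | m.+1 => fun w => w.2.1.2
  end.

Fixpoint traj_hist (pi : policy) (n : nat) : traj n -> hist n :=
  match n return traj n -> hist n with
  | 0 => fun w => w.1
  | m.+1 => fun w =>
      let h := traj_hist pi w.1 in (h, pi m h, w.2.1.1, w.2.2)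
  end.

(* The law of (X_0, Y_0, (S_k, Y_k, X_k)_(k <= n)) under P~^pi_x. *)
Fixpoint traj_law (x : X) (pi : policy) (n : nat) : set (traj n) -> \bar R :=
  match n return set (traj n) -> \bar R with
  | 0 => fun B => Q0 M x [set y | B (x, y)]
  | m.+1 => fun B =>
      (\int[@traj_law x pi m]_w \int[leb]_s \sum_(y' : E0 M) \int[nu M]_x'
        (qtilde s (val y') x' (traj_Y w) (pi m (traj_hist pi w)) *
         \1_B (w, (s, val y', x')))%:E)%E
  end.

Definition Jtilde (x : X) (pi : policy) : \bar R :=
  (\sum_(0 <= k <oo)
    \int[@traj_law x pi k]_w gcost (traj_Y w) (pi k (traj_hist pi w)))%E.

Definition ghat rho r : \bar R :=
  (\sum_(y : E0 M) gcost (val y) r * (massfun_val rho y)%:E)%E.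

Definition Qhat rho r (B : set (borel belief)) : \bar R :=
  (\int[leb]_s \int[nu M]_x
    (\sum_(y : E0 M)
      \1_B (Psi rho r s x) * qtildeSX s x (val y) r * massfun_val rho y)%:E)%E.

(* The law of mu_n under P^^pi_rho. *)
Fixpoint belief_law rho (f : nat -> belief -> ctr) (n : nat)
    : set (borel belief) -> \bar R :=
  if n is m.+1 then
    fun B => (\int[belief_law rho f m]_p Qhat p (f m p) B)%E
  else dirac (rho : borel belief).

Definition V rho (f : nat -> belief -> ctr) : \bar R :=
  (\sum_(0 <= n <oo) \int[belief_law rho f n]_p ghat p (f n p))%E.

Definition belief_policy (f : nat -> belief -> ctr) : policy :=
  fun n h => f n (mu h).

End model_theory.

(* Main.v *)
(** Conditionally on the observed history, the hidden state [Y_n] has law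
    [mu_n]: for nonnegative measurable [F],
      E~[F (mu_n (H_n), Y_n)] = E^[sum_y F (mu_n, y) mu_n(y)].
    This follows by induction on [n], the step being that the filter times its
    denominator is its numerator, which turns one transition of [(mu_n, Y_n)],
    averaged over [Y_n ~ mu_n], into one transition of the filtered model.
    Taking [F (rho, y) = g (y, f_n rho)] the two costs agree term by term.

    The laws of the two models are set functions given by iterated integrals.
    They are measures, and integrals against them are again iterated integrals,
    because an iterated integral is a functional on nonnegative functions that
    is additive, homogeneous and continuous along nondecreasing sequences. *)
From HB Require Import structures.
Require Import Defs.
From mathcomp Require Import all_boot all_order all_algebra finmap.
From mathcomp Require Import all_classical all_reals all_analysis.
From mathcomp Require Import measurable_realfun.

Set Implicit Arguments.
Unset Strict Implicit.
Unset Printing Implicit Defensive.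

Import Order.TTheory GRing.Theory Num.Theory.
Import numFieldNormedType.Exports.

Local Open Scope classical_set_scope.
Local Open Scope ring_scope.

(** * Measures and integrals obtained from monotone functionals *)

Section monotone_functional.
Context d (T : measurableType d) (R : realType).
Local Open Scope ereal_scope.
Implicit Types (I : (T -> \bar R) -> \bar R) (f g : T -> \bar R).

(** The properties of an integral on nonnegative measurable functions, in the manner of Daniell.
    [mf_ge0] is stated without measurability because a measure must be nonnegative as a set function
    on all sets. *)
Record monotone_functional I : Prop := MonotoneFunctional {
  mf_ge0 : forall f, (forall x, 0 <= f x) -> 0 <= I f ;
  mf_le : forall f g, measurable_fun setT f -> measurable_fun setT g ->
    (forall x, 0 <= f x) -> (forall x, f x <= g x) -> I f <= I g ;
  mf_add : forall f g, measurable_fun setT f -> measurable_fun setT g ->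
    (forall x, 0 <= f x) -> (forall x, 0 <= g x) ->
    I (fun x => f x + g x) = I f + I g ;
  mf_scale : forall (k : R) f, (0 <= k)%R -> measurable_fun setT f ->
    (forall x, 0 <= f x) -> I (fun x => k%:E * f x) = k%:E * I f ;
  mf_lim : forall g : (T -> \bar R)^nat,
    (forall n, measurable_fun setT (g n)) -> (forall n x, 0 <= g n x) ->
    (forall x, nondecreasing_seq (g ^~ x)) ->
    I (fun x => limn (g ^~ x)) = limn (fun n => I (g n)) }.

(** Defined on every set, measurable or not, so that the laws of the two models can be identified
    with set functions of this form by a plain equality of functions. *)
Definition mf_set I (B : set T) : \bar R := I (fun x => (\1_B x)%:E).

Section measure.
Variables (I : (T -> \bar R) -> \bar R) (hI : monotone_functional I).

Let mf0 : I (cst 0) = 0.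
Proof.
rewrite -[RHS](mul0e (I (cst 0))) -(mf_scale hI)//.
by congr I; apply/funext => x; rewrite mul0e.
Qed.

Lemma mf_sum (U : Type) (s : seq U) (h : U -> T -> \bar R) :
  (forall i, measurable_fun setT (h i)) -> (forall i x, 0 <= h i x) ->
  I (fun x => \sum_(i <- s) h i x) = \sum_(i <- s) I (h i).
Proof.
move=> mh h0; elim: s => [|i s IH].
  by rewrite big_nil -[RHS]mf0; congr I; apply/funext => x; rewrite big_nil.
rewrite big_cons -IH -(mf_add hI)//.
- by congr I; apply/funext => x; rewrite big_cons.
- exact: emeasurable_sum.
- by move=> x; apply: sume_ge0.
Qed.

Let mf_set0 : mf_set I set0 = 0.
Proof. by rewrite /mf_set -[RHS]mf0; congr I; apply/funext => x; rewrite indic0. Qed.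

Let mf_set_ge0 B : 0 <= mf_set I B.
Proof. by apply: (mf_ge0 hI) => x; rewrite lee_fin. Qed.

Let mf_sigma_additive : semi_sigma_additive (mf_set I).
Proof.
move=> F mF tF mUF.
(* The partial sums of the indicators increase to the indicator of the union, so sigma-additivity
   follows from finite additivity and [mf_lim]. *)
pose g n x : \bar R := \sum_(0 <= i < n) (\1_(F i) x)%:E.
have mi i : measurable_fun setT (fun x => (\1_(F i) x : R)%:E).
  exact/measurable_EFinP/measurable_indic.
have mg n : measurable_fun setT (g n) by exact: emeasurable_sum.
have g0 n x : 0 <= g n x by apply: sume_ge0 => i _; rewrite lee_fin.
have gnd x : nondecreasing_seq (g ^~ x).
  by move=> m n mn; apply: lee_sum_nneg_natr => // i _ _; rewrite lee_fin.
have limg x : limn (g ^~ x) = (\1_(\bigcup_k F k) x)%:E.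
  (* Pointwise convergence of the partial sums is sigma-additivity of the Dirac measure at [x]. *)
  rewrite [RHS](_ : _ = \d_x (\bigcup_k F k)); last by rewrite diracE indicE.
  apply/cvg_lim => //; have := @measure_semi_sigma_additive _ _ _ (\d_x : {measure set T -> \bar R}) F mF tF mUF.
  apply: cvg_trans; apply: near_eq_cvg; near=> n.
  by apply: eq_bigr => i _; rewrite /= diracE indicE.
rewrite (_ : mf_set I (\bigcup_n F n) = I (fun x => limn (g ^~ x))); last first.
  by congr I; apply/funext => x; rewrite limg.
rewrite (mf_lim hI)//.
have -> : (fun n => \sum_(0 <= i < n) mf_set I (F i)) = (fun n => I (g n)).
  by apply/funext => n; rewrite /g mf_sum// => i x; rewrite lee_fin.
apply: ereal_nondecreasing_is_cvgn => m n mn; apply: (mf_le hI) => // x.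
exact: gnd.
Unshelve. all: by end_near.
Qed.

HB.instance Definition _ := isMeasure.Build _ _ _ (mf_set I)
  mf_set0 mf_set_ge0 mf_sigma_additive.

Definition mf_measure : {measure set T -> \bar R} := mf_set I.

Import HBNNSimple.

(** Both sides agree on simple functions by additivity and homogeneity, and both commute with
    nondecreasing limits, so an approximation by simple functions settles the general case. *)
Lemma integral_mf_measure f : measurable_fun setT f -> (forall x, 0 <= f x) ->
  \int[mf_measure]_x f x = I f.
Proof.
move=> mf f0.
pose g := nnsfun_approx measurableT mf.
have gf x : limn (fun n => (g n x)%:E) = f x.
  by apply/cvg_lim => //; exact: cvg_nnsfun_approx.
have gnd x : nondecreasing_seq (fun n => (g n x)%:E).
  by move=> m n mn; rewrite lee_fin; exact/lefP/nd_nnsfun_approx.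
have mg n : measurable_fun setT (fun x => (g n x)%:E).
  exact/measurable_EFinP.
have g0 n x : 0 <= (g n x)%:E by rewrite lee_fin.
have -> : f = (fun x => limn (fun n => (g n x)%:E)) by apply/funext.
rewrite monotone_convergence// (mf_lim hI)//; congr (limn _); apply/funext => n.
rewrite (eq_integral (EFin \o g n))//.
rewrite integral_nnsfun// patch_setT sintegralE.
pose h r x : \bar R := r%:E * (\1_(g n @^-1` [set r]) x)%:E.
(* The values of [g n] are nonnegative, so [|r|] equals [r] on the range; in this form every summand
   is nonnegative for arbitrary [r], as [mf_sum] requires. *)
rewrite (_ : (fun x => _) = (fun x => \sum_(r <- fset_set (range (g n))) h `|r|%R x)); last first.
  apply/funext => x; rewrite fimfunE fsbig_finite//= -sumEFin.
  rewrite big_seq [in RHS]big_seq; apply: eq_bigr => r.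
  rewrite in_fset_set// inE => -[y _ <-].
  by rewrite /h ger0_norm// -EFinM.
rewrite mf_sum; first last.
- by move=> r x; rewrite /h -EFinM lee_fin.
- by move=> r; apply/measurable_EFinP/measurable_funM.
rewrite fsbig_finite//= big_seq [in RHS]big_seq; apply: eq_bigr => r.
rewrite in_fset_set// inE => -[y _ <-].
rewrite ger0_norm// /h (mf_scale hI)//.
exact/measurable_EFinP/measurable_indic/measurable_sfunP.
Qed.

End measure.

Lemma mf_eval z : monotone_functional (fun f => f z).
Proof. by split => // g mg g0 gnd. Qed.

Lemma mf_mule (c : R) I : (0 <= c)%R -> monotone_functional I ->
  monotone_functional (fun f => I f * c%:E).
Proof.
move=> c0 hI; split=> [f f0|f g mf mg f0 fg|f g mf mg f0 g0|k f k0 mf f0|g mg g0 gnd].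
- by rewrite mule_ge0 ?lee_fin// (mf_ge0 hI).
- by rewrite lee_wpmul2r ?lee_fin// (mf_le hI).
- by rewrite (mf_add hI)// ge0_muleDl ?(mf_ge0 hI).
- by rewrite (mf_scale hI)// muleA.
- rewrite (mf_lim hI)// limeMr//.
  apply: ereal_nondecreasing_is_cvgn => m n mn; apply: (mf_le hI) => // x.
  exact: gnd.
Qed.

Lemma mf_cadd I J : monotone_functional I -> monotone_functional J ->
  monotone_functional (fun f => I f + J f).
Proof.
move=> hI hJ; split=> [f f0|f g mf mg f0 fg|f g mf mg f0 g0|k f k0 mf f0|g mg g0 gnd].
- by rewrite adde_ge0// ?(mf_ge0 hI) ?(mf_ge0 hJ).
- by rewrite leeD// ?(mf_le hI) ?(mf_le hJ).
- by rewrite (mf_add hI)// (mf_add hJ)// addeACA.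
- by rewrite (mf_scale hI)// (mf_scale hJ)// muleDr// ge0_adde_def// inE ?(mf_ge0 hI) ?(mf_ge0 hJ).
- have cI : cvgn (fun n => I (g n)).
    by apply: ereal_nondecreasing_is_cvgn => m n mn; apply: (mf_le hI) => // x; exact: gnd.
  have cJ : cvgn (fun n => J (g n)).
    by apply: ereal_nondecreasing_is_cvgn => m n mn; apply: (mf_le hJ) => // x; exact: gnd.
  rewrite (mf_lim hI)// (mf_lim hJ)// -limeD//.
  rewrite ge0_adde_def// inE; apply: lime_ge => //; apply: nearW => n.
    exact: (mf_ge0 hI).
  exact: (mf_ge0 hJ).
Qed.

Lemma mf_zero : monotone_functional (cst 0).
Proof.
split => //= [f g _ _ _ _|k f _ _ _|g _ _ _]; rewrite ?adde0 ?mule0//.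
by rewrite lim_cst.
Qed.

Lemma mf_bigsum (U : Type) (s : seq U) (J : U -> (T -> \bar R) -> \bar R) :
  (forall i, monotone_functional (J i)) ->
  monotone_functional (fun f => \sum_(i <- s) J i f).
Proof.
move=> hJ; elim: s => [|i s IH].
  by under eq_fun do rewrite big_nil; exact: mf_zero.
by under eq_fun do rewrite big_cons; exact: mf_cadd.
Qed.

(** The closure property behind iterated integrals: each rule holds for [J u] pointwise in [u] and
    then for the integral against [m], the limit rule by monotone convergence. *)
Lemma mf_integral d' (U : measurableType d') (m : {measure set U -> \bar R})
    (J : U -> (T -> \bar R) -> \bar R) :
  (forall u, monotone_functional (J u)) ->
  (forall f, measurable_fun setT f -> (forall x, 0 <= f x) ->
    measurable_fun setT (J ^~ f)) ->
  monotone_functional (fun f => \int[m]_u J u f).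
Proof.
move=> hJ mJ; split=> [f f0|f g mf mg f0 fg|f g mf mg f0 g0|k f k0 mf f0|g mg g0 gnd].
- by apply: integral_ge0 => u _; exact: (mf_ge0 (hJ u)).
- have g0 x : 0 <= g x by apply: le_trans (fg x).
  apply: ge0_le_integral => //.
  + by move=> u _; exact: (mf_ge0 (hJ u)).
  + exact: mJ.
  + exact: mJ.
  + by move=> u _; exact: (mf_le (hJ u)).
- rewrite -ge0_integralD//.
  + by apply: eq_integral => u _; rewrite (mf_add (hJ u)).
  + by move=> u _; exact: (mf_ge0 (hJ u)).
  + exact: mJ.
  + by move=> u _; exact: (mf_ge0 (hJ u)).
  + exact: mJ.
- rewrite -ge0_integralZl//.
  + by apply: eq_integral => u _; rewrite (mf_scale (hJ u)).
  + exact: mJ.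
  + by move=> u _; exact: (mf_ge0 (hJ u)).
- rewrite -monotone_convergence//.
  + by apply: eq_integral => u _; rewrite (mf_lim (hJ u)).
  + by move=> n; exact: mJ.
  + by move=> n u _; exact: (mf_ge0 (hJ u)).
  + move=> u _ a b ab; apply: (mf_le (hJ u)) => // x; exact: gnd.
Qed.

End monotone_functional.

(** * Borel measurability of continuous functions; sigma-finiteness of the time measure *)

Lemma continuous_borel_measurable (R : realType) (T : ptopologicalType)
    (f : T -> R) :
  continuous f -> measurable_fun [set: borel T] (f : borel T -> R).
Proof.
move=> /continuousP cf; apply: (measurability _ (RGenOpens.measurableE R)).
move=> _ [_ [a [b ->] <-]]; rewrite setTI; apply: sub_sigma_algebra.
exact/cf/interval_open.
Qed.

Section time_leb_sigma_finite.
Variable R : realType.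

Lemma measurable_time_val :
  measurable_fun [set: borel (time R)] (@time_val R : borel (time R) -> R).
Proof.
apply: (@continuous_borel_measurable R (time R)).
exact: initial_continuous.
Qed.

(** The intervals from 0 to [n] cover the time axis and have finite length. Tonelli arguments for
    integrals over time rest on this. *)
Lemma time_leb_sigma_finite : sigma_finite [set: borel (time R)] (@time_leb R).
Proof.
exists (fun n => @time_val R @^-1` `[0, n%:R]).
  apply/seteqP; split => // t _.
  exists (Num.trunc (time_val t)).+1 => //=; rewrite in_itv/=.
  by apply/andP; split; [exact: (ge0 (t : {nonneg R}))|exact/ltW/truncnS_gt].
move=> n; split.
  by rewrite -[X in measurable X]setTI; exact: measurable_time_val.
apply: (@le_lt_trans _ _ (lebesgue_measure (`[0, n%:R]%classic : set R))).
  apply: le_measure; rewrite ?inE.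
  - apply: measurable_image_time_val.
    by rewrite -[X in measurable X]setTI; exact: measurable_time_val.
  - exact: measurable_itv.
  - by move=> _ [t tn <-].
by rewrite lebesgue_measure_itv/=; case: ifP => _; rewrite ?ltry// -EFinB ltry.
Qed.

HB.instance Definition _ := Measure_isSigmaFinite.Build _ _ _ (@time_leb R)
  time_leb_sigma_finite.

End time_leb_sigma_finite.

(** * Measurability of evaluation on the space of probability measures *)

Section prob_kernel.
Variables (R : realType) (A : pmetricType R).
Local Open Scope ereal_scope.

(* The factor [g ^ n] of the n-th approximation tends to the indicator of the
   complement of [U]. *)
Lemma open_indic_approx (U : set A) : open U -> U != setT ->
  exists h : nat -> A -> R, [/\
    forall n, continuous (h n),
    forall n a, (0 <= h n a <= 1)%R,
    forall a, nondecreasing_seq (h ^~ a) &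
    forall a, h n a @[n --> \oo] --> (\1_U a : R)].
Proof.
move=> oU UT.
have [c Uc] : ~` U !=set0 by apply/set0P; apply: contra UT => /eqP UT; rewrite -(setCK U) UT setC0.
pose e : A -> \bar R := edist_inf (~` U).
(* The distance to the complement is finite because the complement contains the point [c]. *)
have efin a : e a \is a fin_num.
  rewrite ge0_fin_numE ?edist_inf_ge0//; apply: (@le_lt_trans _ _ (edist (a, c))).
    by apply: ereal_inf_lbound; exists c.
  rewrite -ge0_fin_numE ?edist_ge0//; apply/edist_finP; exists (mdist a c + 1)%R => /=.
    by rewrite ltr_wpDl// mdist_ge0.
  by rewrite ballEmdist/= ltrDl.
have ce : continuous (fine \o e).
  by move=> a; apply: fine_cvg; rewrite fineK//; exact: edist_inf_continuous.
have e0 a : (0 <= fine (e a))%R by exact/fine_ge0/edist_inf_ge0.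
pose g a := expR (- fine (e a)).
have cg : continuous g.
  move=> a; apply: continuous_comp; last exact: continuous_expR.
  by apply: cvgN; exact: ce.
have g0 a : (0 <= g a)%R by exact: expR_ge0.
have g1 a : (g a <= 1)%R by rewrite -expR0 ler_expR oppr_le0.
exists (fun n a => 1 - g a ^+ n)%R; split.
- move=> n a; apply: cvgB; first exact: cvg_cst.
  by apply: (@continuous_comp _ _ _ g (fun x => x ^+ n)%R); [exact: cg|exact: exprn_continuous].
- by move=> n a; rewrite subr_ge0 exprn_ile1//= lerBlDl lerDr exprn_ge0.
- by move=> a m n mn; rewrite lerB// ler_wiXn2l.
- move=> a; rewrite indicE; have [Ua|Ua] := pselect (U a).
    rewrite mem_set//= -[X in _ --> X]subr0; apply: cvgB; first exact: cvg_cst.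
    apply: cvg_expr; rewrite ger0_norm// -expR0 ltr_expR oppr_lt0.
    (* A point of the open set [U] has a ball inside [U], hence positive distance to the complement;
       thus [g a < 1] and its powers tend to 0. *)
    rewrite lt_neqAle e0 andbT eq_sym; apply/negP => /eqP ea0.
    have [r r0 rU] : exists2 r : R, (0 < r)%R & ball a r `<=` U.
      by have /nbhs_ballP[r r0 rU] := open_nbhs_nbhs (conj oU Ua); exists r.
    suff : r%:E <= e a by rewrite -(fineK (efin a)) ea0 lee_fin leNgt r0.
    apply: le_ereal_inf_tmp => _ [b Ub <-]; rewrite leNgt; apply/negP.
    by move=> /edist_lt_ball/rU.
  rewrite memNset//=; have -> : g a = 1%R by rewrite /g /e edist_inf0// oppr0 expR0.
  by under eq_fun do rewrite expr1n subrr; exact: cvg_cst.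
Qed.

Lemma measurable_prob_int (v : bcont A) :
  measurable_fun [set: borel (prob A)]
    ((fun m : prob A => prob_int m v) : borel (prob A) -> R).
Proof.
apply: (@continuous_borel_measurable R (prob A)) => m.
apply: (@continuous_comp _ _ _ (@prob_int R A) (fun w : {ptws bcont A -> R} => w v)).
  exact: initial_continuous.
exact: (@proj_continuous {classic bcont A} (fun _ => R) v).
Qed.

(** Dynkin induction from the open sets, which are stable under intersection. For open [U] the mass
    of [U] is the limit of integrals of continuous bounded functions increasing to its indicator,
    and these integrals are weakly continuous in [m]. *)
Lemma measurable_prob_measure (B : set (borel A)) : measurable B ->
  measurable_fun [set: borel (prob A)]
    ((fun m : prob A => prob_measure m B) : borel (prob A) -> \bar R).
Proof.
move: B; apply: (@dynkin_induction _ (borel A) open) => //.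
- by move=> U V oU oV; exact: openI.
- by rewrite (_ : (fun _ => _) = cst 1)//; apply/funext => m; exact: probability_setT.
- move=> U oU; have [->|UT] := eqVneq U setT.
    by rewrite (_ : (fun _ => _) = cst 1)//; apply/funext => m; exact: probability_setT.
  have [h [hc h01 hnd hU]] := open_indic_approx oU UT.
  have mh n : measurable_fun [set: borel A] (h n : borel A -> R).
    exact: (@continuous_borel_measurable R A).
  have bh n : bounded_fun (h n).
    exists 1%R; split => // M M1 a _ /=.
    by have /andP[h0 h1] := h01 n a; rewrite ger0_norm// (le_trans h1)// ltW.
  pose v n : bcont A := exist _ (h n) (conj (hc n) (bh n)).
  apply: (@emeasurable_fun_cvg _ _ _ _ (fun n (m : borel (prob A)) => (prob_int m (v n))%:E)) => //.
    by move=> n; apply/measurable_EFinP; exact: measurable_prob_int.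
  move=> m _.
  have -> : (fun n => (prob_int m (v n))%:E) = fun n => \int[prob_measure m]_a (h n a)%:E.
    apply/funext => n; rewrite /prob_int/= /Rintegral fineK//.
    apply: integrable_fin_num => //; apply: measurable_bounded_integrable => //.
      by apply: (@le_lt_trans _ _ 1); [exact: probability_le1|exact: ltry].
    exact: bh.
  have mU : measurable (U : set (borel A)) by exact: sub_sigma_algebra.
  rewrite -[in X in _ --> X](setIT U) -integral_indic//.
  rewrite (_ : (fun a => _) = (fun a => limn (fun n => (h n a)%:E))); last first.
    by apply/funext => a; apply/esym/cvg_lim => //; apply: cvg_EFin; [exact: nearW|exact: hU].
  apply: cvg_monotone_convergence => //.
  + by move=> n; exact/measurable_EFinP.
  + by move=> n a _; rewrite lee_fin; have /andP[] := h01 n a.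
  + by move=> a _ i j ij; rewrite lee_fin; exact: hnd.
- move=> S mS PS; rewrite (_ : (fun _ => _) = fun m => 1 - prob_measure m S).
    exact: emeasurable_funB.
  by apply/funext => m; rewrite probability_setC.
- move=> F mF tF PF.
  apply: (@emeasurable_fun_cvg _ _ _ _ (fun n (m : borel (prob A)) => \sum_(0 <= i < n) prob_measure m (F i))) => //.
    by move=> n; exact: emeasurable_sum.
  move=> m _; apply: measure_semi_sigma_additive => //.
  exact: bigcupT_measurable.
Qed.

End prob_kernel.

(** * Measurable dependence of integrals on a parameter *)

Lemma measurable_fine (R : realType) : measurable_fun [set: \bar R] fine.
Proof.
move=> _ Y mY; rewrite setTI.
have mEY : measurable (EFin @` Y) by exact: measurable_image_EFin.
(* [fine] sends both infinities to 0, so they belong to the preimage exactly when 0 is in [Y]. *)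
have [Y0|Y0] := pselect (Y 0).
- rewrite (_ : fine @^-1` Y = (EFin @` Y) `|` ([set +oo] `|` [set -oo])%E).
    by apply: measurableU => //; apply: measurableU; exact: emeasurable_set1.
  apply/seteqP; split => [[z| |]|[z| |]] /=; try by [|right; left|right; right].
  + by move=> Yz; left; exists z.
  + by move=> [[w Yw [<-]]//|[]//].
- rewrite (_ : fine @^-1` Y = EFin @` Y)//.
  apply/seteqP; split => [[z| |]//= Yz|_ [z Yz <-]//].
  by exists z.
Qed.

Section parametric_integrals.
Context (R : realType) (A : pmetricType R).
Context dZ (Z : measurableType dZ).
Local Open Scope ereal_scope.

Section prob_kernel_comp.
Variables (m : Z -> prob A)
  (mm : measurable_fun setT (m : Z -> borel (prob A))).

Definition prob_ker (z : Z) : {measure set (borel A) -> \bar R} :=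
  prob_measure (m z).

Let measurable_prob_ker U : measurable U -> measurable_fun setT (prob_ker ^~ U).
Proof. by move=> mU; exact: (measurableT_comp (measurable_prob_measure mU) mm). Qed.

HB.instance Definition _ :=
  isKernel.Build _ _ Z (borel A) R prob_ker measurable_prob_ker.

Let prob_ker_prob z : prob_ker z setT = 1.
Proof. exact: (probability_setT (prob_measure (m z))). Qed.

HB.instance Definition _ :=
  Kernel_isProbability.Build _ _ Z (borel A) R prob_ker prob_ker_prob.

(** A measurable family of probability measures is a finite kernel, and integrating a jointly
    measurable nonnegative function against a finite kernel leaves a measurable function of the
    parameter. *)
Lemma measurable_integral_prob (h : Z -> A -> \bar R) :
  measurable_fun [set: Z * borel A] (fun p => h p.1 p.2) ->
  (forall z a, 0 <= h z a) ->
  measurable_fun setT (fun z => \int[prob_measure (m z)]_a h z a).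
Proof.
move=> mh h0.
have := @measurable_fun_integral_finite_kernel _ _ _ _ _
  (fun p : Z * borel A => h p.1 p.2) prob_ker.
by apply => // p; exact: h0.
Qed.

End prob_kernel_comp.

Lemma measurable_integral_sigma_finite dU (U : measurableType dU)
    (mu : {sigma_finite_measure set U -> \bar R}) (h : Z -> U -> \bar R) :
  measurable_fun [set: Z * U] (fun p => h p.1 p.2) ->
  (forall z u, 0 <= h z u) ->
  measurable_fun setT (fun z => \int[mu]_u h z u).
Proof.
move=> mh h0.
have := @measurable_fun_fubini_tonelli_F _ _ _ _ _ mu (fun p : Z * U => h p.1 p.2).
by apply => // p; exact: h0.
Qed.

End parametric_integrals.

(** * Measurability of flow, intensities, costs and densities *)

Section model_measurability.
Variables (R : realType) (d : nat) (A : pmetricType R) (M : model d A).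

Local Notation X := (borel 'rV[R]_d).
Local Notation T := (time R).
Local Notation leb := (@time_leb R).
Local Notation ctr := (relaxed A).

Lemma lambda_ge0 p : 0 <= lambda M p.
Proof.
have [lo [hi [lo0 _ /(_ p)/andP[+ _]]]] := lambda_bounds M.
by apply: le_trans; exact: ltW.
Qed.

Section along.
Context dZ (Z : measurableType dZ).
Variables (r : Z -> ctr) (y : Z -> X) (t : Z -> T).
Hypotheses (mr : measurable_fun setT (r : Z -> borel ctr))
  (my : measurable_fun setT y) (mt : measurable_fun setT (t : Z -> borel T)).

(** Control, state and time are measurable functions of a parameter [z], here and below, so that the
    same statements serve when they are read off a history, a filter state or an integration
    variable. *)
Lemma measurable_flow :
  measurable_fun setT ((fun z => flow M (r z) (y z) (t z)) : Z -> X).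
Proof.
have := measurableT_comp (flow_measurable M)
  (measurable_fun_pair (measurable_fun_pair mr my) mt).
exact.
Qed.

Lemma measurable_ctrl :
  measurable_fun setT ((fun z => ctrl M (r z) (t z)) : Z -> borel (prob A)).
Proof.
have := measurableT_comp (ctrl_measurable M) (measurable_fun_pair mr mt).
exact.
Qed.

Lemma measurable_integral_ctrl (h : Z -> A -> R) :
  measurable_fun [set: Z * borel A] ((fun p => h p.1 p.2) : Z * borel A -> R) ->
  (forall z a, 0 <= h z a) ->
  measurable_fun setT (fun z => (\int[ctrl_measure M (r z) (t z)]_a (h z a)%:E)%E).
Proof.
move=> mh h0; apply: measurable_integral_prob.
- exact: measurable_ctrl.
- exact/measurable_EFinP.
- by move=> z a; rewrite lee_fin.
Qed.

Lemma measurable_Rintegral_ctrl (h : Z -> A -> R) :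
  measurable_fun [set: Z * borel A] ((fun p => h p.1 p.2) : Z * borel A -> R) ->
  (forall z a, 0 <= h z a) ->
  measurable_fun setT (fun z => (\int[ctrl_measure M (r z) (t z)]_a h z a)%R).
Proof.
move=> mh h0; apply: (@measurableT_comp _ _ _ _ _ _ fine).
  exact: measurable_fine.
exact: measurable_integral_ctrl.
Qed.

End along.

Section along_act.
Context dZ (Z : measurableType dZ).
Variables (r : Z -> ctr) (y : Z -> X) (t : Z -> T).
Hypotheses (mr : measurable_fun setT (r : Z -> borel ctr))
  (my : measurable_fun setT y) (mt : measurable_fun setT (t : Z -> borel T)).

Lemma measurable_flow_act :
  measurable_fun [set: Z * borel A]
    ((fun p => (flow M (r p.1) (y p.1) (t p.1), p.2)) : Z * borel A -> X * borel A).
Proof.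
have m1 := measurable_flow (measurableT_comp mr (@measurable_fst _ _ Z (borel A)))
  (measurableT_comp my (@measurable_fst _ _ Z (borel A)))
  (measurableT_comp mt (@measurable_fst _ _ Z (borel A))).
exact: (measurable_fun_pair m1 measurable_snd).
Qed.

End along_act.

Section Gamma.
Context dZ (Z : measurableType dZ).
Variables (r : Z -> ctr) (y : Z -> X) (t : Z -> T).
Hypotheses (mr : measurable_fun setT (r : Z -> borel ctr))
  (my : measurable_fun setT y) (mt : measurable_fun setT (t : Z -> borel T)).

Lemma measurable_Gamma :
  measurable_fun setT (fun z => Gamma M (y z) (r z) (t z)).
Proof.
have mtv : measurable_fun setT (fun z => time_val (t z)).
  have := measurableT_comp (@measurable_time_val R) mt.
  exact.
apply: measurable_funD; first exact: measurable_funM.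
apply: (@measurableT_comp _ _ _ _ _ _ fine); first exact: measurable_fine.
(* The range of integration depends on [z]; restricting the integrand instead turns this into an
   integral over all times of a function jointly measurable in [z] and the time. *)
under eq_fun do rewrite integral_mkcond.
apply: measurable_integral_sigma_finite; last first.
  move=> z u; apply: erestrict_ge0 => v _; rewrite lee_fin.
  by apply: Rintegral_ge0 => a _; exact: lambda_ge0.
rewrite [X in measurable_fun _ X](_ : _ = fun p : Z * borel T =>
    if time_val p.2 <= time_val (t p.1) then
      (\int[ctrl_measure M (r p.1) p.2]_a
        lambda M (flow M (r p.1) (y p.1) p.2, a))%:E else 0%E); last first.
  apply/funext => p; rewrite /patch; congr (if _ then _ else _).
  by apply/idP/idP; rewrite ?inE.
have mr1 := measurableT_comp mr (@measurable_fst _ _ Z (borel T)).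
have my1 := measurableT_comp my (@measurable_fst _ _ Z (borel T)).
apply: measurable_fun_ifT => //.
  apply: measurable_fun_ler.
    exact: (measurableT_comp (@measurable_time_val R) measurable_snd).
  exact: (measurableT_comp mtv measurable_fst).
apply/measurable_EFinP; apply: measurable_Rintegral_ctrl => //.
  have := measurableT_comp (lambda_measurable M)
    (measurable_flow_act mr1 my1 (@measurable_snd _ _ Z (borel T))).
  exact.
by move=> z a; exact: lambda_ge0.
Qed.

End Gamma.

Section costs_and_densities.
Context dZ (Z : measurableType dZ).
Variables (r : Z -> ctr) (y : Z -> X).
Hypotheses (mr : measurable_fun setT (r : Z -> borel ctr))
  (my : measurable_fun setT y).

Lemma gcost_ge0 (y0 : X) (r0 : ctr) : (0 <= gcost M y0 r0)%E.
Proof.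
apply: integral_ge0 => u _; rewrite mule_ge0// ?lee_fin ?expR_ge0//.
by apply: integral_ge0 => a _; rewrite lee_fin cost_ge0.
Qed.

Lemma measurable_gcost : measurable_fun setT (fun z => gcost M (y z) (r z)).
Proof.
have mr1 := measurableT_comp mr (@measurable_fst _ _ Z (borel T)).
have my1 := measurableT_comp my (@measurable_fst _ _ Z (borel T)).
have mt1 := @measurable_snd _ _ Z (borel T).
apply: measurable_integral_sigma_finite; last first.
  move=> z u; rewrite mule_ge0// ?lee_fin ?expR_ge0//.
  by apply: integral_ge0 => a _; rewrite lee_fin cost_ge0.
apply: emeasurable_funM.
  apply/measurable_EFinP; apply: measurableT_comp => //.
  by apply: measurableT_comp => //; exact: measurable_Gamma.
apply: measurable_integral_ctrl => //.
  have := measurableT_comp (cost_measurable M) (measurable_flow_act mr1 my1 mt1).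
  exact.
by move=> z a; exact: cost_ge0.
Qed.

Variables (s : Z -> T) (x : Z -> X).
Hypotheses (ms : measurable_fun setT (s : Z -> borel T))
  (mx : measurable_fun setT x).

Lemma measurable_qtilde (y' : X) :
  measurable_fun setT (fun z => qtilde M (s z) y' (x z) (y z) (r z)).
Proof.
apply: measurable_funM; first apply: measurable_funM.
- apply: measurableT_comp => //.
  by apply: measurableT_comp => //; exact: measurable_Gamma.
- have mshift : measurable_fun setT ((fun v : X => v - y') : X -> X).
    apply: (@measurability _ _ X X setT (fun v : X => v - y') (@open 'rV[R]_d)) => //.
    move=> _ [U oU <-]; rewrite setTI; apply: sub_sigma_algebra.
    have /continuousP : continuous (fun v : 'rV[R]_d => v - y').
      by move=> v; exact: (cvgB (@cvg_id _ (nbhs v))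
        (@cvg_cst _ y' _ (nbhs v) (nbhs_filter v))).
    exact.
  have := measurableT_comp (feps_measurable M) (measurableT_comp mshift mx).
  exact.
- apply: measurable_Rintegral_ctrl => //.
    have mfa := measurable_flow_act mr my ms.
    apply: measurable_funM.
      have := measurableT_comp (lambda_measurable M) mfa; exact.
    apply: (@measurableT_comp _ _ _ _ _ _ fine); first exact: measurable_fine.
    have := measurableT_comp
      (measurable_kernel (QA M) [set y'] (measurable_set1_space y')) mfa.
    exact.
  by move=> z a; rewrite mulr_ge0 ?lambda_ge0 ?fine_ge0.
Qed.

End costs_and_densities.

End model_measurability.

(** * A countable base of boxes for functions on a finite set *)

Section massfun_borel.
Variables (R : realType) (E : finType).

(** The uniform boxes around [f] generate a filter that converges to [f] in every coordinate, hence
    in the product topology; each neighbourhood therefore contains a box. *)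
Lemma ptws_nbhs_box (f : {ptws E -> R}) (U : set {ptws E -> R}) :
  nbhs f U ->
  exists2 e : R, 0 < e & forall g, (forall y, `|f y - g y| < e) -> U g.
Proof.
pose F := filter_from [set e : R | 0 < e]
  (fun e => [set g : {ptws E -> R} | forall y, `|f y - g y| < e]).
have FF : Filter F.
  apply: filter_from_filter; first by exists 1 => /=.
  move=> e1 e2 /= e10 e20; exists (Num.min e1 e2) => /=.
    by rewrite lt_min e10.
  by move=> g fg; split=> y; have := fg y; rewrite lt_min => /andP[].
have : F --> f.
  apply/cvg_sup => y V [B [[C oC <-] Cf BV]].
  have /nbhs_ballP[e e0 eC] := open_nbhs_nbhs (conj oC Cf).
  by exists e => // g fg; apply: BV; apply: eC; exact: fg.
by move=> /[apply]-[e e0 eU]; exists e => // g fg; exact: eU.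
Qed.

(** Boxes with rational centre and radius of the form [1 / (k + 1)] form a countable base. All such
    boxes index the union; those not contained in [U] contribute the empty set. *)
Lemma ptws_open_box_cover (U : set {ptws E -> R}) : open U ->
  U = \bigcup_(i : {ffun E -> rat} * nat)
    [set g | (forall y, `|g y - ratr (i.1 y)| < i.2.+1%:R^-1) /\
      [set g' : {ptws E -> R} |
        forall y, `|g' y - ratr (i.1 y)| < i.2.+1%:R^-1] `<=` U].
Proof.
move=> oU; apply/seteqP; split => [f Uf|f [i _ [fi]]]; last exact.
have [e e0 eU] := ptws_nbhs_box (open_nbhs_nbhs (conj oU Uf)).
(* The radius is below [e / 2]: two points of a box are each that close to its centre, hence within
   [e] of each other. *)
have [k] := ltr_add_invr (y := 0 : R) (divr_gt0 e0 (ltr0Sn R 1)).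
rewrite add0r => ke.
have k0 : (0 : R) < k.+1%:R^-1 by rewrite invr_gt0.
have H y : {q : rat | `|f y - ratr q| < k.+1%:R^-1}.
  apply: cid; have [q] : exists q, ratr q \in `]f y - k.+1%:R^-1, f y + k.+1%:R^-1[.
    by apply: rat_in_itvoo; rewrite ltrBlDr -addrA ltrDl addr_gt0.
  by rewrite in_itv/= -ltr_distl distrC => fq; exists q.
exists ([ffun y => sval (H y)], k) => //=; split.
  by move=> y; rewrite ffunE; exact: (svalP (H y)).
move=> g gk; apply: eU => y.
have := gk y; rewrite ffunE => gy; have fy := svalP (H y).
rewrite -[f y](subrK (ratr (sval (H y)))) -addrA (le_lt_trans (ler_normD _ _))//.
by rewrite (splitr e) ltrD// ?(lt_trans fy)// distrC (lt_trans gy).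
Qed.

End massfun_borel.

(** * Measurability of the filter *)

Section belief_measurability.
Variables (R : realType) (d : nat) (A : pmetricType R) (M : model d A).

Local Notation X := (borel 'rV[R]_d).
Local Notation T := (time R).
Local Notation ctr := (relaxed A).

Lemma measurable_massfun_val (y : E0 M) :
  measurable_fun setT ((fun p => massfun_val p y) : borel (belief M) -> R).
Proof.
apply: (@continuous_borel_measurable R (belief M)) => p.
apply: (@continuous_comp _ _ _ (@massfun_val R (E0 M))
  (fun w : {ptws E0 M -> R} => w y)).
  exact: initial_continuous.
exact: (@proj_continuous (E0 M) (fun _ => R) y).
Qed.

(** Measurability may be checked on point masses: an open set of beliefs is the trace of a countable
    union of boxes, and membership in a box is a finite conjunction of conditions on coordinates. *)
Lemma measurable_to_belief dZ (Z : measurableType dZ) (g : Z -> belief M) :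
  (forall y, measurable_fun setT (fun z => massfun_val (g z) y)) ->
  measurable_fun setT (g : Z -> borel (belief M)).
Proof.
move=> mg.
apply: (@measurability _ _ Z (borel (belief M)) setT g (@open (belief M))) => //.
move=> _ [_ [U oU <-] <-]; rewrite setTI (ptws_open_box_cover oU).
rewrite !preimage_bigcup; apply: countable_bigcupT_measurable.
  exact: countableP.
move=> i.
have [iU|iU] := pselect ([set g' : {ptws E0 M -> R} |
    forall y, `|g' y - ratr (i.1 y)| < i.2.+1%:R^-1] `<=` U); last first.
  by rewrite (_ : _ @^-1` _ = set0)//; apply/seteqP; split => // z -[].
rewrite (_ : _ @^-1` _ = \bigcap_(y in [set: E0 M])
    ((fun z => massfun_val (g z) y) @^-1`
      `]ratr (i.1 y) - i.2.+1%:R^-1, ratr (i.1 y) + i.2.+1%:R^-1[)); last first.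
  apply/seteqP; split => [z [zi _] y _|z zi] /=.
    by rewrite in_itv/= -ltr_distl; exact: zi.
  split=> // y; have := zi y Logic.I.
  by rewrite /= in_itv/= -ltr_distl.
apply: fin_bigcap_measurable; first exact: finite_finset.
by move=> y _; rewrite -[X in measurable X]setTI; exact: mg.
Qed.

Section filter.
Context dZ (Z : measurableType dZ).
Variables (p : Z -> belief M) (r : Z -> ctr) (s : Z -> T) (x : Z -> X).
Hypotheses (mp : measurable_fun setT (p : Z -> borel (belief M)))
  (mr : measurable_fun setT (r : Z -> borel ctr))
  (ms : measurable_fun setT (s : Z -> borel T)) (mx : measurable_fun setT x).

Lemma measurable_filter_num y' :
  measurable_fun setT (fun z => filter_num (p z) (r z) (s z) (x z) y').
Proof.
apply: measurable_sum => y; apply: measurable_funM.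
  by apply: measurable_qtilde => //; exact: measurable_cst.
have := measurableT_comp (measurable_massfun_val y) mp; exact.
Qed.

Lemma measurable_Psi :
  measurable_fun setT
    ((fun z => Psi (p z) (r z) (s z) (x z)) : Z -> borel (belief M)).
Proof.
apply: measurable_to_belief => y'.
have mden : measurable_fun setT (fun z => filter_den (p z) (r z) (s z) (x z)).
  by apply: measurable_sum => y; exact: measurable_filter_num.
(* The quotient is written with the power [-1], whose measurability is [measurable_powR]; the two
   agree because the denominator is nonnegative. *)
rewrite (_ : (fun z => _) = fun z =>
    if filter_den (p z) (r z) (s z) (x z) == 0 then sval (rho_bar M) y'
    else filter_num (p z) (r z) (s z) (x z) y' *
      (filter_den (p z) (r z) (s z) (x z)) `^ (- 1)); last first.
  apply/funext => z; rewrite /massfun_val/= /filter_fun; case: ifPn => // _.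
  rewrite ffunE powR_inv1// /filter_den sumr_ge0// => y _.
  exact: filter_num_ge0.
apply: measurable_fun_ifT => //.
  exact: measurable_fun_eqr.
apply: measurable_funM; first exact: measurable_filter_num.
by apply: (measurableT_comp (measurable_powR _)).
Qed.

End filter.

Lemma measurable_mu n :
  measurable_fun [set: hist d A n] (@mu R d A M n : hist d A n -> borel (belief M)).
Proof.
elim: n => [|n IH].
  apply: measurable_to_belief => y; rewrite /massfun_val/=.
  rewrite (_ : (fun z => _) = fun z => fine (Q0 M z [set val y])); last first.
    by apply/funext => z; rewrite /= ffunE.
  apply: (@measurableT_comp _ _ _ _ _ _ fine); first exact: measurable_fine.
  exact: (measurable_kernel (Q0 M) _ (measurable_set1_space _)).
apply: measurable_Psi.
- have := measurableT_comp IH (measurableT_comp measurable_fst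
    (measurableT_comp (@measurable_fst _ _ (hist d A n * borel ctr)%type (borel T))
      (@measurable_fst _ _ (hist d A n * borel ctr * borel T)%type X))).
  exact.
- have := measurableT_comp (@measurable_snd _ _ (hist d A n) (borel ctr))
    (measurableT_comp (@measurable_fst _ _ (hist d A n * borel ctr)%type (borel T))
      (@measurable_fst _ _ (hist d A n * borel ctr * borel T)%type X)).
  exact.
- have := measurableT_comp (@measurable_snd _ _ (hist d A n * borel ctr)%type (borel T))
      (@measurable_fst _ _ (hist d A n * borel ctr * borel T)%type X).
  exact.
- exact: measurable_snd.
Qed.

Lemma belief_policy_PiD (f : nat -> belief M -> ctr) :
  (forall n, measurable_fun [set: borel (belief M)]
     (f n : borel (belief M) -> borel ctr)) ->
  PiD (belief_policy f).
Proof. by move=> mf n; have := measurableT_comp (mf n) (@measurable_mu n); exact. Qed.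

End belief_measurability.

(** * The law of the filtered model *)

Section belief_chain.
Variables (R : realType) (d : nat) (A : pmetricType R) (M : model d A).

Local Notation X := (borel 'rV[R]_d).
Local Notation T := (time R).
Local Notation ctr := (relaxed A).
Local Notation leb := (@time_leb R).
Local Notation bel := (borel (belief M)).
Local Open Scope ereal_scope.

(** The transition operator of [Qhat] acting on functions. The denominator of the filter is the
    density of the next jump time and observation when the hidden state has law [p]. *)
Definition belief_step (p : belief M) (r : ctr) (F : bel -> \bar R) : \bar R :=
  \int[leb]_s \int[nu M]_x (F (Psi p r s x) * (filter_den p r s x)%:E).

Lemma filter_den_ge0 (p : belief M) (r : ctr) s x : (0 <= filter_den p r s x)%R.
Proof. by apply: sumr_ge0 => y _; exact: filter_num_ge0. Qed.

Lemma QhatE (p : belief M) r B :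
  Qhat p r B = belief_step p r (fun q => (\1_B q)%:E).
Proof.
apply: eq_integral => s _; apply: eq_integral => x _; rewrite -EFinM; congr EFin.
rewrite /filter_den/= exchange_big/= mulr_sumr; apply: eq_bigr => y _.
by rewrite /qtildeSX -mulrA mulr_suml.
Qed.

Section measurability.
Context dZ (Z : measurableType dZ).
Variables (p : Z -> belief M) (r : Z -> ctr).
Hypotheses (mp : measurable_fun setT (p : Z -> bel))
  (mr : measurable_fun setT (r : Z -> borel ctr)).
Variables (s : Z -> T) (x : Z -> X).
Hypotheses (ms : measurable_fun setT (s : Z -> borel T))
  (mx : measurable_fun setT x).

Lemma measurable_filter_den :
  measurable_fun setT (fun z => filter_den (p z) (r z) (s z) (x z)).
Proof. by apply: measurable_sum => y; exact: measurable_filter_num. Qed.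

Lemma measurable_belief_step_integrand (F : bel -> \bar R) :
  measurable_fun setT F ->
  measurable_fun setT (fun z => F (Psi (p z) (r z) (s z) (x z)) *
    (filter_den (p z) (r z) (s z) (x z))%:E).
Proof.
move=> mF; apply: emeasurable_funM.
  have := measurableT_comp mF (measurable_Psi mp mr ms mx); exact.
exact/measurable_EFinP/measurable_filter_den.
Qed.

End measurability.

Lemma measurable_belief_step dZ (Z : measurableType dZ)
    (p : Z -> belief M) (r : Z -> ctr) (F : bel -> \bar R) :
  measurable_fun setT (p : Z -> bel) ->
  measurable_fun setT (r : Z -> borel ctr) ->
  measurable_fun setT F -> (forall q, 0 <= F q) ->
  measurable_fun setT (fun z => belief_step (p z) (r z) F).
Proof.
move=> mp mr mF F0.
have H0 z s x : 0 <= F (Psi (p z) (r z) s x) * (filter_den (p z) (r z) s x)%:E.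
  by rewrite mule_ge0// lee_fin filter_den_ge0.
apply: measurable_integral_sigma_finite; last first.
  by move=> z s; apply: integral_ge0 => x _.
apply: (@measurable_integral_sigma_finite _ _ (Z * borel T)%type _ _ _
  (fun z x => F (Psi (p z.1) (r z.1) z.2 x) * (filter_den (p z.1) (r z.1) z.2 x)%:E)) => //.
have m1 := @measurable_fst _ _ (Z * borel T)%type X.
apply: measurable_belief_step_integrand => //.
- have := measurableT_comp mp (measurableT_comp measurable_fst m1); exact.
- have := measurableT_comp mr (measurableT_comp measurable_fst m1); exact.
- have := measurableT_comp (@measurable_snd _ _ Z (borel T)) m1; exact.
Qed.

Lemma belief_step_functional p r : monotone_functional (belief_step p r).
Proof.
apply: mf_integral => [s|F mF F0].
  apply: mf_integral => [x|F mF F0].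
    have := mf_mule (filter_den_ge0 p r s x) (mf_eval R (Psi p r s x : bel)); exact.
  by apply: measurable_belief_step_integrand.
apply: (@measurable_integral_sigma_finite _ _ (borel T)) => //.
  exact: measurable_belief_step_integrand.
by move=> s x; rewrite mule_ge0// lee_fin filter_den_ge0.
Qed.

Section law.
Variable f : nat -> belief M -> ctr.
Hypothesis mf : forall n, measurable_fun [set: bel] (f n : bel -> borel ctr).

Lemma belief_law_step (m : {measure set bel -> \bar R}) n :
  monotone_functional (fun F : bel -> \bar R => \int[m]_p belief_step p (f n p) F).
Proof.
apply: mf_integral => [p|F mF F0]; first exact: belief_step_functional.
exact: measurable_belief_step.
Qed.

(** [belief_law] is a bare set function defined by recursion; a measure with the same values on all
    sets makes the rules of integration available. The step applies the functional of
    [belief_law_step] to the measure found at stage [n]. *)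
Lemma belief_law_measure rho n : exists m : {measure set bel -> \bar R},
  belief_law rho f n = m :> (set bel -> \bar R).
Proof.
elim: n => [|n [m hm]]; first by exists (\d_(rho : bel)).
exists (mf_measure (belief_law_step m n)); apply/funext => B /=.
by rewrite hm /mf_set; apply: eq_integral => p _; rewrite QhatE.
Qed.

(** The recursion for sets extended to functions: the tower property with respect to the last
    transition. *)
Lemma integral_belief_lawS rho n (F : bel -> \bar R) :
  measurable_fun setT F -> (forall q, 0 <= F q) ->
  \int[belief_law rho f n.+1]_p F p =
  \int[belief_law rho f n]_p belief_step p (f n p) F.
Proof.
move=> mF F0; have [m hm] := belief_law_measure rho n.
have -> : belief_law rho f n.+1 = mf_measure (belief_law_step m n).
  apply/funext => B /=.
  by rewrite hm /mf_set; apply: eq_integral => p _; rewrite QhatE.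
by rewrite integral_mf_measure// hm.
Qed.

End law.

End belief_chain.

(** * The law of the partially observable model *)

Section trajectories.
Variables (R : realType) (d : nat) (A : pmetricType R) (M : model d A).

Local Notation X := (borel 'rV[R]_d).
Local Notation T := (time R).
Local Notation ctr := (relaxed A).
Local Notation leb := (@time_leb R).
Local Notation step := (borel T * X * X)%type.
Local Open Scope ereal_scope.

(** The expectation of [F] over the next jump time, hidden state and observation, from hidden state
    [y] under control [r]; integrals and sum are nested as in [traj_law]. *)
Definition traj_step (y : X) (r : ctr) (F : step -> \bar R) : \bar R :=
  \int[leb]_s \sum_(y' : E0 M) \int[nu M]_x'
    (F (s, val y', x') * (qtilde M s (val y') x' y r)%:E).

Section measurability.
Context dZ (Z : measurableType dZ).
Variables (y : Z -> X) (r : Z -> ctr) (F : Z -> step -> \bar R).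
Hypotheses (my : measurable_fun setT y)
  (mr : measurable_fun setT (r : Z -> borel ctr))
  (mF : measurable_fun [set: Z * step] (fun p => F p.1 p.2))
  (F0 : forall z v, 0 <= F z v).

Lemma measurable_traj_step_integrand (y' : E0 M) :
  measurable_fun [set: Z * borel T * X]
    (fun z => F z.1.1 (z.1.2, val y', z.2) *
      (qtilde M z.1.2 (val y') z.2 (y z.1.1) (r z.1.1))%:E).
Proof.
have m1 := @measurable_fst _ _ (Z * borel T)%type X.
have m11 := measurableT_comp (@measurable_fst _ _ Z (borel T)) m1.
have m12 := measurableT_comp (@measurable_snd _ _ Z (borel T)) m1.
have m2 := @measurable_snd _ _ (Z * borel T)%type X.
apply: emeasurable_funM.
  have mv : measurable_fun [set: Z * borel T * X] (cst (val y' : X)).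
    exact: measurable_cst.
  have := measurableT_comp mF (measurable_fun_pair m11
    (measurable_fun_pair (measurable_fun_pair m12 mv) m2)).
  exact.
apply/measurable_EFinP/measurable_qtilde.
- have := measurableT_comp mr m11; exact.
- have := measurableT_comp my m11; exact.
- exact: m12.
- exact: m2.
Qed.

Let integrand_ge0 z s (y' : E0 M) x' :
  0 <= F z (s, val y', x') * (qtilde M s (val y') x' (y z) (r z))%:E.
Proof. by rewrite mule_ge0// lee_fin qtilde_ge0. Qed.

Lemma measurable_traj_step_inner (y' : E0 M) :
  measurable_fun [set: Z * borel T]
    (fun z => \int[nu M]_x' (F z.1 (z.2, val y', x') *
      (qtilde M z.2 (val y') x' (y z.1) (r z.1))%:E)).
Proof.
apply: (@measurable_integral_sigma_finite _ _ (Z * borel T)%type _ _ _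
  (fun z x' => F z.1 (z.2, val y', x') *
      (qtilde M z.2 (val y') x' (y z.1) (r z.1))%:E)) => //.
exact: measurable_traj_step_integrand.
Qed.

Lemma measurable_traj_step :
  measurable_fun setT (fun z => traj_step (y z) (r z) (F z)).
Proof.
apply: measurable_integral_sigma_finite; last first.
  by move=> z s; apply: sume_ge0 => y' _; apply: integral_ge0.
apply: emeasurable_sum => y'; exact: measurable_traj_step_inner.
Qed.

End measurability.

Lemma traj_step_functional y r : monotone_functional (traj_step y r).
Proof.
have mc dU (U : measurableType dU) dV (V : measurableType dV)
    (F : V -> \bar R) (mF : measurable_fun setT F) :
    measurable_fun [set: U * V] (fun p => F p.2).
  exact: (measurableT_comp mF measurable_snd).
apply: mf_integral => [s|F mF F0].
  apply: mf_bigsum => y'; apply: mf_integral => [x'|F mF F0].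
    have := mf_mule (qtilde_ge0 M s (val y') x' y r)
      (mf_eval R ((s, val y', x') : step)); exact.
  (* [X] serves as a dummy parameter space: all parameters are constant on it, and the section at
     [(y, s)] is taken afterwards. *)
  have mi := @measurable_traj_step_integrand _ X (cst y) (cst r) (fun _ => F)
    (measurable_cst _) (measurable_cst _) (mc _ _ _ _ _ mF) y'.
  have := measurableT_comp mi
    (@pair1_measurable _ _ (X * borel T)%type X (y, s)).
  exact.
apply: emeasurable_sum => y'.
have mi := @measurable_traj_step_inner _ X (cst y) (cst r) (fun _ => F)
  (measurable_cst _) (measurable_cst _) (mc _ _ _ _ _ mF) (fun _ => F0) y'.
have := measurableT_comp mi (@pair1_measurable _ _ X (borel T) y).
exact.
Qed.

Section law.
Variables (x : X) (pi : policy d A).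
Hypothesis mpi : PiD pi.

Lemma measurable_traj_Y n : measurable_fun [set: traj R d n] (@traj_Y R d n : traj R d n -> X).
Proof.
case: n => [|n]; first exact: measurable_snd.
have := measurableT_comp (@measurable_snd _ _ (borel T) X)
  (measurableT_comp (@measurable_fst _ _ (borel T * X)%type X)
    (@measurable_snd _ _ (traj R d n) step)).
exact.
Qed.

Lemma measurable_traj_hist n :
  measurable_fun [set: traj R d n] (@traj_hist R d A pi n).
Proof.
elim: n => [|n IH]; first exact: measurable_fst.
have mh := measurableT_comp IH (@measurable_fst _ _ (traj R d n) step).
have m2 := @measurable_snd _ _ (traj R d n) step.
have ms := measurableT_comp (@measurable_fst _ _ (borel T) X)
  (measurableT_comp (@measurable_fst _ _ (borel T * X)%type X) m2).
have mx := measurableT_comp (@measurable_snd _ _ (borel T * X)%type X) m2.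
have mr := measurableT_comp (@mpi n) mh.
have := measurable_fun_pair (measurable_fun_pair (measurable_fun_pair mh mr) ms) mx.
exact.
Qed.

Let h n (w : traj R d n) := traj_hist pi w.

Lemma traj_law_step n (m : {measure set (traj R d n) -> \bar R}) :
  monotone_functional (fun F : traj R d n.+1 -> \bar R =>
    \int[m]_w traj_step (traj_Y w) (pi (h w)) (fun v => F (w, v))).
Proof.
apply: mf_integral => [w|F mF F0].
  (* For fixed [w] the rules are those of [traj_step] applied to the section of [F] at [w], which
     inherits measurability. *)
  have [a b c e g] := traj_step_functional (traj_Y w) (pi (h w)).
  have mw (F : traj R d n.+1 -> \bar R) : measurable_fun setT F ->
      measurable_fun setT (fun v : step => F (w, v)).
    move=> mF; have := measurableT_comp mF (@pair1_measurable _ _ (traj R d n) step w).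
    exact.
  split.
  - by move=> F F0; exact: a.
  - by move=> F G mF mG F0 FG; apply: b => //; exact: mw.
  - by move=> F G mF mG F0 G0; apply: c => //; exact: mw.
  - by move=> k F k0 mF F0; apply: e => //; exact: mw.
  - move=> G mG G0 ndG; apply: (g (fun n v => G n (w, v))) => // k; exact: mw.
apply: (@measurable_traj_step _ (traj R d n) (@traj_Y R d n)
  (fun w => pi (h w)) (fun w v => F (w, v))) => //.
- exact: measurable_traj_Y.
- have := measurableT_comp (@mpi n) (@measurable_traj_hist n); exact.
- rewrite (_ : (fun p => _) = F)//; by apply/funext => -[].
Qed.

Lemma traj_lawSE n (m : {measure set (traj R d n) -> \bar R}) :
  @traj_law R d A M x pi n = m :> (set _ -> \bar R) ->
  @traj_law R d A M x pi n.+1 = mf_measure (traj_law_step m) :> (set _ -> \bar R).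
Proof.
move=> hm; apply/funext => B /=; rewrite hm /mf_set.
apply: eq_integral => w _; apply: eq_integral => s _.
apply: eq_bigr => y' _; apply: eq_integral => x' _.
by rewrite -EFinM mulrC.
Qed.

(** The initial law is the image of [Q0] under pairing with the observed [x]; later laws come from
    the functional of one transition. *)
Lemma traj_law_measure n : exists m : {measure set (traj R d n) -> \bar R},
  @traj_law R d A M x pi n = m :> (set _ -> \bar R).
Proof.
elim: n => [|n [m hm]].
  by exists (pushforward (Q0 M x) (fun y : X => (x, y))).
by exists (mf_measure (traj_law_step m)); exact: traj_lawSE.
Unshelve. exact: pair1_measurable.
Qed.

Lemma integral_traj_lawS n (F : traj R d n.+1 -> \bar R) :
  measurable_fun setT F -> (forall w, 0 <= F w) ->
  \int[@traj_law R d A M x pi n.+1]_w F w =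
  \int[@traj_law R d A M x pi n]_w
    traj_step (traj_Y w) (pi (h w)) (fun v => F (w, v)).
Proof.
move=> mF F0; have [m hm] := traj_law_measure n.
by rewrite (traj_lawSE hm) integral_mf_measure// hm.
Qed.

End law.

End trajectories.

(** * The filter as conditional law of the hidden state *)

Section filtering_identity.
Variables (R : realType) (d : nat) (A : pmetricType R) (M : model d A).

Local Notation X := (borel 'rV[R]_d).
Local Notation T := (time R).
Local Notation ctr := (relaxed A).
Local Notation leb := (@time_leb R).
Local Notation bel := (borel (belief M)).
Local Open Scope ereal_scope.

(** The expectation of [F (p, Y)] when the hidden state [Y] has law [p]. *)
Definition belief_mean (F : bel * X -> \bar R) (p : belief M) : \bar R :=
  \sum_(y : E0 M) F (p, val y) * (massfun_val p y)%:E.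

Lemma belief_mean_ge0 F p : (forall z, 0 <= F z) -> 0 <= belief_mean F p.
Proof.
by move=> F0; apply: sume_ge0 => y _; rewrite mule_ge0// lee_fin massfun_ge0.
Qed.

Lemma measurable_belief_mean F : measurable_fun setT F ->
  measurable_fun setT (belief_mean F : bel -> \bar R).
Proof.
move=> mF; apply: emeasurable_sum => y; apply: emeasurable_funM.
  have := measurableT_comp mF (@pair2_measurable _ _ bel X (val y)); exact.
apply/measurable_EFinP; have := measurable_massfun_val y; exact.
Qed.

Lemma Q0_set1_fin (x y : X) : Q0 M x [set y] \is a fin_num.
Proof.
apply: (@kernel_finite_transition _ _ _ _ _ (Q0 M) x [set y]).
exact: measurable_set1_space.
Qed.

(** [Q0] is carried by the finite set [E0], so [G] may be replaced almost everywhere by the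
    combination [G'] of indicators of the points of [E0]. *)
Lemma integral_Q0 (x : X) (G : X -> \bar R) :
  measurable_fun setT G -> (forall y, 0 <= G y) ->
  \int[Q0 M x]_y G y =
  \sum_(y : E0 M) G (val y) * (massfun_val (prior M x) y)%:E.
Proof.
move=> mG G0.
pose G' (y : X) : \bar R := \sum_(e : E0 M) G (val e) * (\1_[set val e] y)%:E.
have mi (e : E0 M) : measurable_fun [set: X] (fun y : X => (\1_[set val e] y : R)%:E).
  apply/measurable_EFinP/measurable_indic.
  have := measurable_set1_space (val e : X); exact.
have i0 (e : E0 M) (y : X) : 0 <= (\1_[set val e] y : R)%:E by rewrite lee_fin.
have mE0 : measurable ([set` E0 M] : set X).
  rewrite -[X in measurable X]image_id -bigcup_imset1.
  apply: fin_bigcup_measurable => // y _; exact: measurable_set1_space.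
rewrite (@ge0_ae_eq_integral _ _ _ (Q0 M x) setT G G')//.
- rewrite ge0_integral_sum//; last 2 first.
  + by move=> e; exact: measurable_funeM.
  + by move=> e y _; rewrite mule_ge0.
  apply: eq_bigr => e _; rewrite ge0_integralZl//.
  rewrite integral_indic//; last exact: measurable_set1_space.
  rewrite setIT /massfun_val/= ffunE fineK//.
  exact: Q0_set1_fin.
- by apply: emeasurable_sum => e; exact: measurable_funeM.
- by move=> y _; apply: sume_ge0 => e _; rewrite mule_ge0.
(* [G] and [G'] agree on [E0], and the complement is null because [E0] has the full mass 1. *)
- exists (~` [set` E0 M]); split.
  + exact: measurableC.
  + have : Q0 M x ([set` E0 M] `|` ~` [set` E0 M]) =
        Q0 M x [set` E0 M] + Q0 M x (~` [set` E0 M]).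
      by rewrite measureU// ?setICr//; exact: measurableC.
    rewrite setUv (@prob_kernel _ _ _ _ _ (Q0 M) x) (Q0_E0 M x).
    have := measure_ge0 (Q0 M x) (~` [set` E0 M]).
    case: (Q0 M x (~` [set` E0 M])) => [q| |]// _ [].
    by rewrite -[X in X = _]addr0 => /addrI <-.
  + move=> y /= yGG' yE; apply: yGG' => _.
    rewrite /G' (bigD1 [` yE]%fset)//= big1; last first.
      move=> e ey; rewrite indicE memNset ?mule0//= => /esym ye.
      by move/eqP: ey; apply; exact: val_inj.
    by rewrite indicE mem_set//= mule1 adde0.
Qed.

(* Where the denominator of the filter vanishes, so does its numerator: the
   arbitrary value rho_bar plays no role. *)
Lemma massfun_val_Psi (p : belief M) (r : ctr) s x y' :
  (massfun_val (Psi p r s x) y' * filter_den p r s x = filter_num p r s x y')%R.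
Proof.
rewrite /massfun_val/= /filter_fun; case: ifPn => [/eqP den0|den0].
  apply/esym; rewrite den0 mulr0; apply/eqP; rewrite eq_le filter_num_ge0 andbT.
  rewrite -den0 /filter_den (bigD1 y')//= lerDl sumr_ge0// => y _.
  exact: filter_num_ge0.
by rewrite ffunE divfK.
Qed.

Section step.
Variables (p : belief M) (r : ctr) (F : bel * X -> \bar R).
Hypotheses (mF : measurable_fun setT F) (F0 : forall z, 0 <= F z).

(** The contribution of the current hidden state [y] to the integrand at jump time [s] and
    observation [x]. *)
Let h (y : E0 M) (s : T) (x : X) : \bar R :=
  (\sum_(y' : E0 M) F (Psi p r s x, val y') *
    (qtilde M s (val y') x (val y) r)%:E) * (massfun_val p y)%:E.

Let Fq_ge0 s x (y y' : E0 M) :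
  0 <= F (Psi p r s x, val y') * (qtilde M s (val y') x (val y) r)%:E.
Proof. by rewrite mule_ge0// lee_fin qtilde_ge0. Qed.

Let h_ge0 y s x : 0 <= h y s x.
Proof.
by rewrite mule_ge0 ?lee_fin ?massfun_ge0// sume_ge0.
Qed.

Let measurable_Fq (y y' : E0 M) : measurable_fun [set: borel T * X]
  (fun z => F (Psi p r z.1 z.2, val y') *
    (qtilde M z.1 (val y') z.2 (val y) r)%:E).
Proof.
have mp : measurable_fun [set: borel T * X] (cst (p : bel)) by exact: measurable_cst.
have mr : measurable_fun [set: borel T * X] (cst (r : borel ctr)) by exact: measurable_cst.
have my (e : E0 M) : measurable_fun [set: borel T * X] (cst (val e : X)) by exact: measurable_cst.
apply: emeasurable_funM.
  have := measurableT_comp mF (measurable_fun_pair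
    (measurable_Psi mp mr measurable_fst measurable_snd) (my y')).
  exact.
apply/measurable_EFinP.
have := measurable_qtilde M mr (my y) measurable_fst measurable_snd (val y').
exact.
Qed.

Let measurable_h y : measurable_fun [set: borel T * X] (fun z => h y z.1 z.2).
Proof.
apply: emeasurable_funM; last exact/measurable_EFinP/measurable_cst.
by apply: emeasurable_sum => y'; exact: measurable_Fq.
Qed.

Let measurable_section (G : borel T * X -> \bar R) s :
  measurable_fun setT G -> measurable_fun setT (fun x => G (s, x)).
Proof.
by move=> mG; have := measurableT_comp mG (@pair1_measurable _ _ (borel T) X s); exact.
Qed.

(** Bayes' rule at fixed [(s, x)]: after exchanging the sums over old and new hidden states, the
    inner sum is the numerator of the filter, that is, filter times denominator. *)
Let hE s x : \sum_(y : E0 M) h y s x =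
  belief_mean F (Psi p r s x) * (filter_den p r s x)%:E.
Proof.
rewrite /h /belief_mean.
rewrite [RHS]ge0_sume_distrl; last first.
  by move=> y _; rewrite mule_ge0// lee_fin massfun_ge0.
under [RHS]eq_bigr do rewrite -muleA -EFinM massfun_val_Psi.
under [LHS]eq_bigr do rewrite ge0_sume_distrl//.
rewrite exchange_big/=; apply: eq_bigr => y' _.
rewrite /filter_num -sumEFin ge0_sume_distrr; last first.
  by move=> y _; rewrite lee_fin mulr_ge0 ?qtilde_ge0 ?massfun_ge0.
by apply: eq_bigr => y _; rewrite -muleA -EFinM.
Qed.

(** The induction step of the filtering identity. The weight of [y] and the finite sums are moved
    through both integrals, all terms being nonnegative, and [hE] then identifies the integrands. *)
Lemma traj_step_mean :
  \sum_(y : E0 M)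
    traj_step M (val y) r (fun v => F (Psi p r v.1.1 v.2, v.1.2)) *
      (massfun_val p y)%:E =
  belief_step p r (belief_mean F).
Proof.
transitivity (\sum_(y : E0 M) \int[leb]_s \int[nu M]_x h y s x).
  apply: eq_bigr => y _.
  rewrite -ge0_integralZr//; last 3 first.
  - apply: emeasurable_sum => y'.
    by apply: (@measurable_integral_sigma_finite _ _ (borel T) _ _ _
      (fun s x => F (Psi p r s x, val y') *
        (qtilde M s (val y') x (val y) r)%:E)).
  - by move=> s _; apply: sume_ge0 => y' _; apply: integral_ge0 => x _; exact: Fq_ge0.
  - by rewrite lee_fin massfun_ge0.
  apply: eq_integral => s _ /=.
  rewrite -ge0_integral_sum//; last 2 first.
  - by move=> y'; have := measurable_section s (measurable_Fq y y'); exact.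
  - by move=> y' x _; exact: Fq_ge0.
  rewrite -ge0_integralZr//; last 3 first.
  - by apply: emeasurable_sum => y'; have := measurable_section s (measurable_Fq y y'); exact.
  - by move=> x _; apply: sume_ge0 => y' _; exact: Fq_ge0.
  - by rewrite lee_fin massfun_ge0.
rewrite -ge0_integral_sum//; last 2 first.
- by move=> y; exact: (@measurable_integral_sigma_finite _ _ (borel T)).
- by move=> y s _; apply: integral_ge0 => x _; exact: h_ge0.
apply: eq_integral => s _; rewrite -ge0_integral_sum//.
- by apply: eq_integral => x _; exact: hE.
- by move=> y; have := measurable_section s (measurable_h y); exact.
Qed.

End step.

Variables (x : X) (f : nat -> belief M -> ctr).
Hypothesis mf : forall n, measurable_fun [set: bel] (f n : bel -> borel ctr).

(** The induction keeps [F] general, since the hypothesis at [n] is applied to the function that one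
    transition makes of [F]. *)
Lemma integral_traj_law n (F : bel * X -> \bar R) :
  measurable_fun setT F -> (forall z, 0 <= F z) ->
  \int[@traj_law R d A M x (belief_policy f) n]_w
    F (mu M (traj_hist (belief_policy f) w), traj_Y w) =
  \int[belief_law (prior M x) f n]_p belief_mean F p.
Proof.
have mpi := belief_policy_PiD mf.
elim: n F => [|n IH] F mF F0.
  rewrite integral_dirac//; last exact: measurable_belief_mean.
  rewrite diracT mul1e -[RHS]/(belief_mean F (prior M x)) /belief_mean.
  have mx : measurable_fun [set: X] (fun y : X => (x, y)).
    exact: pair1_measurable.
  have mG : measurable_fun [set: X * X] (fun w => F (prior M w.1, w.2)).
    have := measurableT_comp mF (measurable_fun_pair
      (measurableT_comp (@measurable_mu R d A M 0) measurable_fst) measurable_snd).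
    exact.
  (* At time 0 the first coordinate is the fixed [x] and the second has law [Q0], so the integral
     reduces to the sum of [integral_Q0]. *)
  have := @ge0_integral_pushforward _ _ X (X * X)%type R (fun y => (x, y)) mx
    (Q0 M x) setT (fun w => F (prior M w.1, w.2)) measurableT mG (fun w _ => F0 _).
  rewrite preimage_setT => h; rewrite [LHS]h.
  rewrite integral_Q0// => [|y]; last exact: F0.
  have := measurableT_comp mG mx; exact.
rewrite integral_traj_lawS//; last first.
  have := measurableT_comp mF (measurable_fun_pair
      (measurableT_comp (@measurable_mu R d A M n.+1) (measurable_traj_hist mpi (n := n.+1)))
      (@measurable_traj_Y R d n.+1)).
  exact.
(* The control depends on the history through the filter only, so the expectation over the next
   transition is a function [G] of the current filter and hidden state, to which the induction
   hypothesis applies. *)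
pose G (z : bel * X) := traj_step M z.2 (f n z.1)
  (fun v => F (Psi z.1 (f n z.1) v.1.1 v.2, v.1.2)).
rewrite [LHS](IH G); first last.
- move=> z; apply: integral_ge0 => s _; apply: sume_ge0 => y' _.
  by apply: integral_ge0 => x' _; rewrite mule_ge0// lee_fin qtilde_ge0.
- have mfn := measurableT_comp (mf n) (@measurable_fst _ _ bel X).
  have m1 := @measurable_fst _ _ (bel * X)%type (borel T * X * X)%type.
  have m2 := @measurable_snd _ _ (bel * X)%type (borel T * X * X)%type.
  have m21 := measurableT_comp (@measurable_fst _ _ (borel T * X)%type X) m2.
  have mPsi := measurable_Psi (measurableT_comp measurable_fst m1)
    (measurableT_comp mfn m1)
    (measurableT_comp (@measurable_fst _ _ (borel T) X) m21)
    (measurableT_comp (@measurable_snd _ _ (borel T * X)%type X) m2).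
  have mFPsi := measurableT_comp mF (measurable_fun_pair mPsi
    (measurableT_comp (@measurable_snd _ _ (borel T) X) m21)).
  exact: (@measurable_traj_step R d A M _ (bel * X)%type snd (f n \o fst)
    (fun z v => F (Psi z.1 (f n z.1) v.1.1 v.2, v.1.2)) measurable_snd mfn mFPsi
    (fun z v => F0 _)).
have GE : belief_mean G = fun p => belief_step p (f n p) (belief_mean F).
  by apply/funext => p; exact: (traj_step_mean p (f n p) mF F0).
rewrite GE integral_belief_lawS//.
- exact: measurable_belief_mean.
- by move=> q; exact: belief_mean_ge0.
Qed.

End filtering_identity.

(** * Equality of the two costs *)

Theorem lemma4p4 (R : realType) (d : nat) (A : pmetricType R) (M : model d A)
    (x : 'rV[R]_d) (f : nat -> belief M -> relaxed A)
    (mf : forall n, measurable_fun [set: borel (belief M)]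
       (f n : borel (belief M) -> borel (relaxed A))) :
  PiD (belief_policy f) /\
  V (prior M x) f = Jtilde M x (belief_policy f).
Proof.
split; first exact: belief_policy_PiD.
apply: eq_eseriesr => n _.
(* With this choice [belief_mean F p] is [ghat p (f n p)] by definition, so the filtering identity
   is the equality of the [n]-th terms. *)
pose F (z : borel (belief M) * borel 'rV[R]_d) := gcost M z.2 (f n z.1).
have mF : measurable_fun setT F.
  have := measurable_gcost M (measurableT_comp (mf n) measurable_fst)
    (@measurable_snd _ _ (borel (belief M)) (borel 'rV[R]_d)).
  exact.
have F0 z : (0 <= F z)%E by exact: gcost_ge0.
by have := integral_traj_law x mf n mF F0; exact: esym.
Qed.
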